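(* Let $V\subset\mathbb{P}^3$ be a space curve parameterized by $x_i=f_i(t)$, $i=0,\dots,3$, $t=(t_0:t_1)$, and let $\delta=\max\{\deg f_i(t),\ i=0,\dots,3\}$. Let $G\notin V$ be a sufficiently generic point, let $P_0,P_1$ be random (sufficiently generic) points, let $\xi=(\xi_0:\xi_1:\xi_2:\xi_3)$ be a symbolic point, and for $j=0,1$ let $H_j$ be the linear form in $x_0,\dots,x_3$, with coefficients linear polynomials in $\xi$, defining the plane through $\xi,G,P_j$. Let $R_V^G$ be the Sylvester resultant, eliminating $t$, of $$H_0(f_0(t):\ldots:f_3(t))\quad\text{and}\quad H_1(f_0(t):\ldots:f_3(t)).$$ Then $R_V^G$, as a polynomial in $\xi$, factors into a degree $\delta$ polynomial defining a surface $S_V^{G}$ containing the space curve $V$, and the polynomial $E_L^{\delta}$, where $E_L$ is a linear polynomial defining the plane passing through the points $G,P_0,P_1$.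
   Context: The parameterization is projective: the $f_i$ are homogeneous polynomials in $(t_0,t_1)$ of the same degree. A symbolic point is a point whose coordinates $\xi_0,\dots,\xi_3$ are indeterminates. The planes $H_0=0$ and $H_1=0$ intersect along the line $L$ through $\xi$ and $G$. ''Random'' points are understood to be sufficiently generic. *)

(* Defs.v *)
From mathcomp Require Import all_boot all_order all_algebra.
From mathcomp Require Export mpoly.

Set Implicit Arguments.
Unset Strict Implicit.
Unset Printing Implicit Defensive.

Import GRing.Theory.
Local Open Scope ring_scope.

Section Resultant.
Variable R : comNzRingType.

(* Coefficient of t_0^(d - k) t_1^k. *)
Definition form_coef (d : nat) (p : {mpoly R[2]}) (k : nat) : R :=
  p@_[multinom [tuple (d - k)%N; k]].

(* The formal degrees m and n are explicit: unlike in [mxpoly.Sylvester_mx],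
   where they are read off the sizes of univariate polynomials, a root at
   infinity (a vanishing leading coefficient) does not shrink the matrix. *)
Definition form_Sylvester_mx (m n : nat) (p q : {mpoly R[2]}) : 'M[R]_(n + m) :=
  \matrix_(i, j)
    match split i with
    | inl k => form_coef m p (j - k)%N *+ (k <= j <= k + m)%N
    | inr k => form_coef n q (j - k)%N *+ (k <= j <= k + n)%N
    end.

Definition form_resultant (m n : nat) (p q : {mpoly R[2]}) : R :=
  \det (form_Sylvester_mx m n p q).

End Resultant.

Section Curve.
Variable K : fieldType.

(* Points of projective space are represented by nonzero row vectors of
   homogeneous coordinates. *)

Definition param_eval (f : 4.-tuple {mpoly K[2]}) (t : 'rV[K]_2) : 'rV[K]_4 :=
  \row_i (tnth f i).@[t 0].

Definition param_deg (f : 4.-tuple {mpoly K[2]}) : nat :=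
  \max_(i < 4) (msize (tnth f i)).-1.

(* The f_i are forms of one and the same degree without common zero on P^1, so
   that t |-> (f_0(t) : ... : f_3(t)) is a morphism P^1 -> P^3. Its image is a
   curve rather than a point exactly when the degree is positive. *)
Definition curve_param (f : 4.-tuple {mpoly K[2]}) : Prop :=
  [/\ forall i, tnth f i \is (param_deg f).-homog,
      forall t : 'rV[K]_2, t != 0 -> param_eval f t != 0
    & (0 < param_deg f)%N].

Definition on_curve (f : 4.-tuple {mpoly K[2]}) (x : 'rV[K]_4) : Prop :=
  exists t : 'rV[K]_2, exists c : K,
    [/\ t != 0, c != 0 & x = c *: param_eval f t].

(* The plane through three points, as a matrix whose row space is the
   corresponding linear subspace. *)
Definition span3 (a b c : 'rV[K]_4) : 'M[K]_(3, 4) :=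
  \matrix_(i < 3) nth 0 [:: a; b; c] i.

Definition noncollinear (a b c : 'rV[K]_4) : Prop := row_free (span3 a b c).

Definition defines_plane (E : {mpoly K[4]}) (a b c : 'rV[K]_4) : Prop :=
  E \is 1.-homog /\
  forall x : 'rV[K]_4, (E.@[x 0] == 0) = (x <= span3 a b c)%MS.

(* The plane through the symbolic point xi, G and P: det(xi, G, P, x), a linear
   form in x over K[xi_0, ..., xi_3]. The inner polynomial ring is in xi, the
   outer one in x. *)
Definition plane_form (G P : 'rV[K]_4) : {mpoly {mpoly K[4]}[4]} :=
  \det (\matrix_(i < 4) nth 0
    [:: \row_j ('X_j : {mpoly K[4]})%:MP_[4];
        \row_j ((G 0 j)%:MP_[4])%:MP_[4];
        \row_j ((P 0 j)%:MP_[4])%:MP_[4];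
        \row_j 'X_j ] i : 'M[{mpoly {mpoly K[4]}[4]}]_4).

(* Substitution x_i := f_i(t_0, t_1), the f_i being viewed over K[xi]. *)
Definition plane_form_on_curve (f : 4.-tuple {mpoly K[2]}) (G P : 'rV[K]_4) :
    {mpoly {mpoly K[4]}[2]} :=
  plane_form G P \mPo [tuple map_mpoly (@mpolyC 4 K) (tnth f i) | i < 4].

Definition curve_resultant (f : 4.-tuple {mpoly K[2]}) (G P0 P1 : 'rV[K]_4) :
    {mpoly K[4]} :=
  form_resultant (param_deg f) (param_deg f)
    (plane_form_on_curve f G P0) (plane_form_on_curve f G P1).

End Curve.

(* Main.v *)
Require Import Defs.
From mathcomp Require Import all_boot all_order all_algebra.
From mathcomp Require Import mpoly ring zify.

Set Implicit Arguments.
Unset Strict Implicit.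
Unset Printing Implicit Defensive.

Import GRing.Theory.
Local Open Scope ring_scope.

(** Write [x y z w] for the determinant of four points of K^4 and d for the
    degree of the parameterization. The plane through x, G and P is the linear
    form with coefficients c_i = [x G P e_i].

    For two binary forms of the same degree d the Sylvester matrix consists of
    four square Toeplitz blocks, U_p and L_p above U_q and L_q. The triangular
    blocks U_p and U_q commute, so its determinant is that of the d by d matrix
    U_p L_q - U_q L_p ([det_sylv]). This matrix is bilinear and alternating in
    (p, q): if p = sum_i c_i f_i and q = sum_k e_k f_k, it equals
    sum_(i, k) (c_i e_k - c_k e_i) U_(f_i) L_(f_k) ([det_sylv_comb]).

    When c and e are the planes through x, G, P0 and through x, G, P1, the
    three-term Pluecker relation gives
    c_i e_k - c_k e_i = [x G P0 P1] [x G e_i e_k]. The factor E = [x G P0 P1]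
    leaves the determinant with exponent d, and what remains,
    S(x) = det (sum_(i, k) [x G e_i e_k] U_(f_i) L_(f_k)), is a d by d
    determinant of linear forms in x ([det_sylv_planes], [curve_resultantE]).

    Two properties of S exploit that it involves neither P0 nor P1.
    - S vanishes on V ([cone_on_curve]): given x in V, either all [x G e_i e_k]
      are zero and S(x) = 0, or the two auxiliary points can be taken among the
      e_i with E(x) nonzero; both planes then meet the curve at x, so the
      resultant vanishes, hence so does S(x).
    - S is not zero ([cone_neq0]): up to sign and a power of a coordinate of G,
      its value at the intersection point of two planes l, m through G with a
      third plane off G is the resultant of l(f) and m(f) ([cone_neq0_planes]).
      Since G is off the curve, l and m can be chosen so that these two forms
      have no common zero. *)

(** * Brackets of four points *)

Section Bracket.
Variable R : comNzRingType.
Implicit Types x y z w : 'rV[R]_4.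

Definition bracket x y z w : R :=
  \det (\matrix_(i < 4) nth 0 [:: x; y; z; w] i).

Let det3 (M : 'M[R]_3) (c : nat -> nat -> R) : (forall i j, M i j = c i j) ->
  \det M =
    c 0%N 0%N * (c 1%N 1%N * c 2%N 2%N - c 1%N 2%N * c 2%N 1%N)
  - c 0%N 1%N * (c 1%N 0%N * c 2%N 2%N - c 1%N 2%N * c 2%N 0%N)
  + c 0%N 2%N * (c 1%N 0%N * c 2%N 1%N - c 1%N 1%N * c 2%N 0%N).
Proof.
move=> E; do !rewrite (expand_det_row _ ord0) /cofactor !big_ord_recl big_ord0.
rewrite !det_mx00 !mxE !E /= /bump /= /addn /=; ring.
Qed.

(** The Laplace expansion along the first two rows; it turns the bracket
    identities below into polynomial identities in the coordinates. *)
Lemma bracketE x y z w (c := fun (u : 'rV[R]_4) k => u 0 (inord k))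
    (m := fun a b => c z a * c w b - c z b * c w a)
    (l := fun a b => c x a * c y b - c x b * c y a) :
  bracket x y z w =
      l 0%N 1%N * m 2%N 3%N - l 0%N 2%N * m 1%N 3%N + l 0%N 3%N * m 1%N 2%N
    + l 1%N 2%N * m 0%N 3%N - l 1%N 3%N * m 0%N 2%N + l 2%N 3%N * m 0%N 1%N.
Proof.
rewrite {}/m {}/l.
have E (u : 'rV[R]_4) i : u 0 i = c u (nat_of_ord i) by rewrite /c inord_val.
move: (c) E => {}c E.
rewrite /bracket (expand_det_row _ ord0) /cofactor !big_ord_recl big_ord0.
have D h : \det (row' ord0 (col' h (\matrix_i [:: x; y; z; w]`_i))) =
    let e i k := c (nth 0 [:: y; z; w] i) (bump h k) in
      e 0%N 0%N * (e 1%N 1%N * e 2%N 2%N - e 1%N 2%N * e 2%N 1%N)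
    - e 0%N 1%N * (e 1%N 0%N * e 2%N 2%N - e 1%N 2%N * e 2%N 0%N)
    + e 0%N 2%N * (e 1%N 0%N * e 2%N 1%N - e 1%N 1%N * e 2%N 0%N).
  by apply: (det3 (c := fun i j => c _ (bump h j))) => i j; rewrite !mxE E.
rewrite !{}D !mxE /= !E /= /bump /= /addn /=; ring.
Qed.

Definition dot x y := \sum_i x 0 i * y 0 i.

Lemma dotE x y (c := fun (u : 'rV[R]_4) k => u 0 (inord k)) :
  dot x y = c x 0%N * c y 0%N + c x 1%N * c y 1%N
          + c x 2%N * c y 2%N + c x 3%N * c y 3%N.
Proof.
have E (u : 'rV[R]_4) i : u 0 i = c u (nat_of_ord i) by rewrite /c inord_val.
by rewrite /dot !big_ord_recl big_ord0 !E /= addr0 !addrA.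
Qed.

(** For fixed independent x and y the bracket is an alternating form on the
    quotient of the space by their span; as this quotient has dimension two,
    such a form satisfies the three-term Pluecker relation. *)
Lemma bracket_plucker x y p q u v :
  bracket x y p u * bracket x y q v - bracket x y p v * bracket x y q u =
  bracket x y p q * bracket x y u v.
Proof. rewrite !bracketE /=; ring. Qed.

Lemma bracket_swap03 x y z w : bracket w y z x = - bracket x y z w.
Proof. rewrite !bracketE /=; ring. Qed.

Lemma bracket_alt03 x y z : bracket x y z x = 0.
Proof. rewrite !bracketE /=; ring. Qed.

Lemma bracketDr x y z : {morph bracket x y z : u v / u + v}.
Proof. move=> u v; rewrite !bracketE /= !mxE; ring. Qed.

Lemma bracketZr x y z a w : bracket x y z (a *: w) = a * bracket x y z w.
Proof. rewrite !bracketE /= !mxE; ring. Qed.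

Lemma bracket_dot x y z w :
  bracket x y z w = \sum_i w 0 i * bracket x y z (delta_mx 0 i).
Proof.
rewrite {1}[w]row_sum_delta (big_morph _ (bracketDr x y z) (id1 := 0)).
  by apply: eq_bigr => i _; rewrite bracketZr.
by rewrite -[0 in LHS](scale0r 0) bracketZr mul0r.
Qed.

(** The four-dimensional cross product: the linear form of the plane through
    three points or, dually, the intersection point of three planes. *)
Definition cross l m y : 'rV[R]_4 := \row_i bracket l m y (delta_mx 0 i).

Lemma dot_delta x i : dot x (delta_mx 0 i) = x 0 i.
Proof.
rewrite /dot (bigD1 i) //= mxE !eqxx mulr1 big1 ?addr0 // => k ki.
by rewrite mxE eqxx (negPf ki) mulr0.
Qed.

(** Pairing the intersection point of the planes l, m, y with G, u and v gives,
    by Cauchy-Binet, the 3 by 3 determinant of the values of l, m, y at G, u, v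
    up to sign; only one minor survives when l and m vanish at G. *)
Lemma bracket_cross l m y G u v : dot l G = 0 -> dot m G = 0 ->
  bracket (cross l m y) G u v =
  - dot y G * (dot l u * dot m v - dot l v * dot m u).
Proof.
move=> lG mG.
(* Cauchy-Binet, expanded along the values of y, l and m at G. *)
transitivity (- dot y G * (dot l u * dot m v - dot l v * dot m u)
    + dot l G * (dot y u * dot m v - dot y v * dot m u)
    + dot m G * (dot l u * dot y v - dot l v * dot y u)); last first.
  by rewrite lG mG !mul0r !addr0.
clear lG mG.
have D j : cross l m y 0 j = bracket l m y (delta_mx 0 j) by rewrite mxE.
rewrite bracketE /= !D !bracketE !dotE /= !mxE !eqxx /=.
by rewrite -!val_eqE /= !inordK //=; ring.
Qed.

End Bracket.

(** * The Sylvester determinant as a bilinear Bezout determinant *)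

Lemma det_block_comm_lreg (R : comNzRingType) n (A B C D : 'M[R]_n) :
  A *m C = C *m A -> GRing.lreg (\det A) ->
  \det (block_mx A B C D) = \det (A *m D - C *m B).
Proof.
move=> AC regA; apply: regA.
have <- : \det (block_mx 1%:M 0 (- C) A) = \det A.
  by rewrite det_lblock det1 mul1r.
rewrite -det_mulmx mulmx_block !mul1mx !mul0mx !addr0 !mulNmx.
rewrite AC addNr addrC det_ublock det_lblock det1 mul1r.
by [].
Qed.

(** Replacing A by 'X + A makes the determinant of the first block a monic
    polynomial, hence regular; the identity then specializes at 'X = 0. *)
Lemma det_block_comm (R : comNzRingType) n (A B C D : 'M[R]_n) :
  A *m C = C *m A -> \det (block_mx A B C D) = \det (A *m D - C *m B).
Proof.
move=> AC; pose Ax := 'X%:M + map_mx polyC A.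
pose P M : 'M[{poly R}]_n := map_mx polyC M.
have ACx : Ax *m P C = P C *m Ax.
  by rewrite mulmxDl mulmxDr -scalar_mxC -!map_mxM AC.
have regA : GRing.lreg (\det Ax).
  have -> : \det Ax = char_poly (- A).
    by rewrite /char_poly /char_poly_mx map_mxN opprK.
  exact/monic_lreg/char_poly_monic.
have /(congr1 (horner_eval 0)) := det_block_comm_lreg (P B) (P D) ACx regA.
rewrite -!det_map_mx map_block_mx map_mxB !map_mxM.
have ev M : map_mx (horner_eval 0) (P M) = M.
  by apply/matrixP => i j; rewrite !mxE /horner_eval hornerC.
have -> : map_mx (horner_eval 0) Ax = A.
  apply/matrixP => i j; rewrite !mxE /horner_eval hornerD hornerC hornerMn.
  by rewrite hornerX mul0rn add0r.
by rewrite !ev.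
Qed.

Section Blocks.
Variables (R : comNzRingType) (d : nat).
Implicit Types p q : nat -> R.

(** The halves of the Sylvester rows of a form of degree d: the coefficient of
    index j - i, with the column j running over the first d columns for
    [toep_up] and over the last d columns for [toep_low]. *)
Definition toep_up p : 'M[R]_d := \matrix_(i, j) (p (j - i)%N *+ (i <= j)%N).

Definition toep_low p : 'M[R]_d :=
  \matrix_(i, j) (p (d + j - i)%N *+ (j <= i)%N).

Definition sylv p q : 'M[R]_(d + d) :=
  block_mx (toep_up p) (toep_low p) (toep_up q) (toep_low q).

(** Both products are truncations of the product of the two forms: reversing
    the summation range between i and j exchanges them. *)
Lemma toep_upC p q : toep_up p *m toep_up q = toep_up q *m toep_up p.
Proof.
apply/matrixP => i j; rewrite !mxE.
pose h (k : 'I_d) := if (i <= k <= j)%N then insubd k (i + j - k)%N else k.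
have hE (k : 'I_d) : (i <= k <= j)%N -> h k = (i + j - k)%N :> nat.
  move=> ikj; rewrite /h ikj val_insubd ifT //.
  by move: (ltn_ord j); lia.
have hh : involutive h.
  move=> k; have [ikj|ikj] := boolP (i <= k <= j)%N.
    by apply: val_inj; rewrite /= !hE ?hE //; lia.
  by rewrite {2}/h (negPf ikj) /h (negPf ikj).
rewrite (reindex_inj (inv_inj hh)); apply: eq_bigr => k _; rewrite !mxE.
have [ikj|ikj] := boolP (i <= k <= j)%N.
  rewrite (hE _ ikj).
  have [-> ->] : (i + j - k - i = j - k)%N /\ (j - (i + j - k) = k - i)%N.
    by lia.
  have [-> -> -> ->] : [/\ i <= k, k <= j, i <= i + j - k & i + j - k <= j]%N
    by split; lia.
  by rewrite mulrC.
rewrite /h (negPf ikj).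
by case: (i <= k)%N ikj; case: (k <= j)%N => //= _;
  rewrite !mulr0n ?mul0r ?mulr0.
Qed.

Lemma det_sylv p q : \det (sylv p q) =
  \det (toep_up p *m toep_low q - toep_up q *m toep_low p).
Proof. exact/det_block_comm/toep_upC. Qed.

(** Coefficients of the form l(f), where a i lists the coefficients of f_i. *)
Definition comb (l : 'rV[R]_4) (a : 'I_4 -> nat -> R) : nat -> R :=
  fun n => \sum_i l 0 i * a i n.

(** The Bezout-like matrix of two linear combinations of the f_i depends on the
    two linear forms only through their 2 by 2 minors w; keeping w as an
    argument lets other tensors proportional to these minors be substituted. *)
Definition bezout_mx (a : 'I_4 -> nat -> R) (w : 'I_4 -> 'I_4 -> R) : 'M[R]_d :=
  \sum_i \sum_k w i k *: (toep_up (a i) *m toep_low (a k)).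

Lemma toep_up_comb l a : toep_up (comb l a) = \sum_i l 0 i *: toep_up (a i).
Proof.
apply/matrixP => i j; rewrite summxE !mxE /comb -sumrMnl.
by apply: eq_bigr => k _; rewrite !mxE mulrnAr.
Qed.

Lemma toep_low_comb l a : toep_low (comb l a) = \sum_i l 0 i *: toep_low (a i).
Proof.
apply/matrixP => i j; rewrite summxE !mxE /comb -sumrMnl.
by apply: eq_bigr => k _; rewrite !mxE mulrnAr.
Qed.

Lemma toep_mul_comb l m a : toep_up (comb l a) *m toep_low (comb m a) =
  \sum_i \sum_k (l 0 i * m 0 k) *: (toep_up (a i) *m toep_low (a k)).
Proof.
rewrite toep_up_comb toep_low_comb mulmx_suml; apply: eq_bigr => i _.
rewrite mulmx_sumr; apply: eq_bigr => k _.
by rewrite -scalemxAl -scalemxAr scalerA.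
Qed.

Lemma det_sylv_comb l m a : \det (sylv (comb l a) (comb m a)) =
  \det (bezout_mx a (fun i k => l 0 i * m 0 k - l 0 k * m 0 i)).
Proof.
rewrite det_sylv !toep_mul_comb -sumrB; congr (\det _); apply: eq_bigr => i _.
rewrite -sumrB; apply: eq_bigr => k _; rewrite -scalerBl.
by rewrite [m 0 i * _]mulrC.
Qed.

Lemma det_bezout_mxZ a c w :
  \det (bezout_mx a (fun i k => c * w i k)) = c ^+ d * \det (bezout_mx a w).
Proof.
rewrite -detZ /bezout_mx scaler_sumr; congr (\det _); apply: eq_bigr => i _.
by rewrite scaler_sumr; apply: eq_bigr => k _; rewrite scalerA.
Qed.

Lemma eq_bezout_mx a w w' :
  (forall i k, w i k = w' i k) -> bezout_mx a w = bezout_mx a w'.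
Proof.
by move=> E; apply: eq_bigr => i _; apply: eq_bigr => k _; rewrite E.
Qed.

Lemma form_Sylvester_mxE (p q : {mpoly R[2]}) :
  form_Sylvester_mx d d p q = sylv (form_coef d p) (form_coef d q).
Proof.
rewrite /sylv; apply/matrixP => i j; rewrite mxE.
rewrite -(splitK i) -(splitK j) unsplitK.
have := ltn_ord; case: (split i) => k; case: (split j) => l /= lt_d;
  move: (lt_d _ k) (lt_d _ l) => ltk ltl.
- rewrite block_mxEul mxE; congr (_ *+ nat_of_bool _); lia.
- rewrite block_mxEur mxE; congr (_ *+ nat_of_bool _); lia.
- rewrite block_mxEdl mxE; congr (_ *+ nat_of_bool _); lia.
- rewrite block_mxEdr mxE; congr (_ *+ nat_of_bool _); lia.
Qed.

End Blocks.

(** * Vanishing of the Sylvester determinant *)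

(** A Sylvester row is the coefficient list of the form shifted by k, so pairing
    it with any w only sees d.+1 consecutive values of w. *)
Lemma toep_sum (R : comNzRingType) d (p w : nat -> R) (k : 'I_d) :
  \sum_(j < d) toep_up d p k j * w j +
  \sum_(j < d) toep_low d p k j * w (d + j)%N
  = \sum_(i < d.+1) p i * w (k + i)%N.
Proof.
pose F j := if (k <= j < k + d.+1)%N then p (j - k)%N * w j else 0.
transitivity (\sum_(j < d + d) F j).
  rewrite big_split_ord /=; congr (_ + _); apply: eq_bigr => j _.
    have ltj := ltn_ord j; rewrite mxE /F; have -> : (j < k + d.+1)%N by lia.
    by rewrite andbT; case: ifP => _; rewrite ?mul0r.
  have ltk := ltn_ord k; rewrite mxE /F; have -> : (k <= d + j)%N by lia.
  have -> : (d + j < k + d.+1)%N = (j <= k)%N by lia.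
  by rewrite /=; case: (_ <= _)%N; rewrite ?mul0r.
have ltk := ltn_ord k.
rewrite -(big_mkord xpredT F) (big_cat_nat (n := k)) //=; last by lia.
rewrite big_nat big1 ?add0r => [|j /andP[_ jk]]; last by rewrite /F leqNgt jk.
rewrite (big_cat_nat (n := (k + d.+1)%N)) /=; [|lia|lia].
rewrite [X in _ + X]big_nat [X in _ + X]big1 ?addr0 => [|j /andP[kj _]];
  last first.
  by rewrite /F [(j < _)%N]ltnNge kj andbF.
rewrite -{1}[val k]add0n [(k + _)%N]addnC big_addn addnK big_mkord.
apply: eq_bigr => i _; rewrite /F addnK addnC leq_addr ltn_add2l.
by rewrite ltn_ord.
Qed.

Definition form_eval (R : comNzRingType) d (p : nat -> R) (s t : R) : R :=
  \sum_(i < d.+1) p i * (s ^+ (d - i) * t ^+ i).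

(** The vector of monomials of degree 2d - 1 at a zero (s : t) of the form is
    killed by the Sylvester rows: they compute the values at (s : t) of the form
    times the monomials of degree d - 1. *)
Lemma toep_root (R : comNzRingType) d (p : nat -> R) (s t : R) :
  form_eval d p s t = 0 ->
  toep_up d p *m (\col_j (s ^+ (d + d.-1 - j) * t ^+ j)) +
  toep_low d p *m (\col_j (s ^+ (d.-1 - j) * t ^+ (d + j))) = 0.
Proof.
move=> p0; apply/matrixP => k z; rewrite !mxE.
pose w j := s ^+ (d + d.-1 - j) * t ^+ j.
transitivity (\sum_(i < d.+1) p i * w (k + i)%N).
  rewrite -toep_sum; congr (_ + _); apply: eq_bigr => j _; congr (_ * _);
    rewrite mxE //.
  by rewrite /w subnDl.
transitivity (s ^+ (d.-1 - k) * t ^+ k * form_eval d p s t); last first.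
  by rewrite p0 mulr0.
rewrite /form_eval mulr_sumr; apply: eq_bigr => i _; rewrite /w.
have -> : (d + d.-1 - (k + i) = (d.-1 - k) + (d - i))%N.
  by move: (ltn_ord k) (ltn_ord i); lia.
by rewrite !exprD; ring.
Qed.

Lemma det_sylv_root (R : idomainType) d (p q : nat -> R) (s t : R) :
  (0 < d)%N -> (s != 0) || (t != 0) ->
  form_eval d p s t = 0 -> form_eval d q s t = 0 -> \det (sylv d p q) = 0.
Proof.
move=> d0 st ps qs.
pose v := col_mx (\col_(j < d) (s ^+ (d + d.-1 - j) * t ^+ j))
                (\col_(j < d) (s ^+ (d.-1 - j) * t ^+ (d + j))).
have : sylv d p q *m v = 0 by rewrite mul_block_col !toep_root // col_mx0.
move/(congr1 (mulmx (\adj (sylv d p q)))).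
rewrite mulmxA mul_adj_mx mulmx0 mul_scalar_mx.
move=> v0; apply/eqP/contraT => det_n0.
have {}v0 j : v j 0 = 0.
  move/matrixP/(_ j 0)/eqP: v0.
  by rewrite !mxE mulf_eq0 (negPf det_n0) => /eqP.
(* The first entry of v is s^(2d-1) and its last one is t^(2d-1). *)
case/orP: st => /negPf n0.
  have := v0 (lshift d (Ordinal d0)); rewrite col_mxEu mxE expr0 mulr1.
  by move/eqP; rewrite expf_eq0 n0 andbF.
have ltd : (d.-1 < d)%N by lia.
have := v0 (rshift d (Ordinal ltd)); rewrite col_mxEd mxE subnn expr0 mul1r.
by move/eqP; rewrite expf_eq0 n0 andbF.
Qed.

Lemma mul_toep_up (R : comNzRingType) d (u : 'rV[R]_d) (p : nat -> R)
    (j : 'I_d) :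
  (u *m toep_up d p) 0 j = (rVpoly u * \poly_(i < d.+1) p i)`_j.
Proof.
rewrite /rVpoly poly_def mulr_suml coef_sum mxE; apply: eq_bigr => k _.
rewrite valK -scalerAl coefZ coefXnM coef_poly mxE.
have -> : (j - k < d.+1)%N by move: (ltn_ord j); lia.
by rewrite ltnNge; case: leqP.
Qed.

Lemma mul_toep_low (R : comNzRingType) d (u : 'rV[R]_d) (p : nat -> R)
    (j : 'I_d) :
  (u *m toep_low d p) 0 j = (rVpoly u * \poly_(i < d.+1) p i)`_(d + j).
Proof.
rewrite /rVpoly poly_def mulr_suml coef_sum mxE; apply: eq_bigr => k _.
rewrite valK -scalerAl coefZ coefXnM coef_poly mxE.
have -> : (d + j < k)%N = false by move: (ltn_ord k); lia.
have -> : (d + j - k < d.+1)%N = (j <= k)%N by move: (ltn_ord k); lia.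
by case: leqP.
Qed.

(** A vector (a, b) in the left kernel is a relation a P + b Q = 0 with a and b
    of degree less than d. Being prime to Q, P divides b; as P has degree
    exactly d, b is zero, and then so is a. In terms of forms, the hypothesis
    [p d != 0] excludes a common zero at infinity. *)
Lemma det_sylv_neq0 (K : fieldType) d (p q : nat -> K) :
  p d != 0 -> coprimep (\poly_(i < d.+1) p i) (\poly_(i < d.+1) q i) ->
  \det (sylv d p q) != 0.
Proof.
move=> pd; set P := \poly_(i < _) p i; set Q := \poly_(i < _) q i => PQ.
apply/det0P => -[v vn0]; rewrite -[v]hsubmxK mul_row_block => /eqP.
rewrite row_mx_eq0 => /andP[/eqP up0 /eqP low0].
set a := lsubmx v in up0 low0; set b := rsubmx v in up0 low0.
have E : rVpoly a * P + rVpoly b * Q = 0.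
  apply/polyP => j; rewrite coef0; have [jd|dj] := ltnP j d.
    move/matrixP/(_ 0 (Ordinal jd)): up0.
    by rewrite mxE !mul_toep_up mxE coefD.
  have [jd|dj2] := ltnP (j - d) d.
    move/matrixP/(_ 0 (Ordinal jd)): low0.
    by rewrite mxE !mul_toep_low mxE coefD /= subnKC.
  have sz (u : 'rV[K]_d) (r : nat -> K) :
      (size ((rVpoly u * \poly_(i < d.+1) r i)%R : {poly K}) <= j)%N.
    apply: (leq_trans (size_polyMleq _ _)).
    have := size_poly d (fun k => if insub k is Some i then u 0 i else 0).
    by move: (size_poly d.+1 r); rewrite -/(rVpoly u); lia.
  by rewrite coefD !nth_default ?sz ?addr0.
have szP : size P = d.+1 by rewrite size_poly_eq.
have szu (u : 'rV[K]_d) : (size (rVpoly u) < size P)%N.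
  by rewrite szP ltnS size_poly.
have b0 : rVpoly b = 0.
  apply/eqP; apply: contraTT (szu b) => bn0.
  rewrite -leqNgt; apply: dvdp_leq => //.
  rewrite -(Gauss_dvdpl _ PQ) -(dvdp_addr _ (dvdp_mull (rVpoly a) (dvdpp P))).
  by rewrite E dvdp0.
move/eqP: E; rewrite b0 mul0r addr0 mulf_eq0.
rewrite -[P == 0]size_poly_eq0 szP orbF => /eqP a0.
case/eqP: vn0; rewrite -[v]hsubmxK -/a -/b -[a]rVpolyK -[b]rVpolyK a0 b0.
by rewrite !linear0 row_mx0.
Qed.

(** * Binary forms and their coefficients *)

Lemma mdeg2 (m : 'X_{1..2}) : mdeg m = (m 0%R + m 1%R)%N.
Proof.
rewrite mdegE !big_ord_recl big_ord0 addn0.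
by congr (_ + m _)%N; apply: val_inj.
Qed.

Lemma multinom2_deg (m : 'X_{1..2}) :
  [multinom [tuple (mdeg m - m 1%R)%N; m 1%R]] = m.
Proof.
apply/mnmP => i; rewrite multinomE (tnth_nth 0%N) mdeg2 addnK.
by case: i => -[|[|//]] i /=; congr (m _); apply: val_inj.
Qed.

Lemma dhomog2_coef (R : comNzRingType) d (p : {mpoly R[2]}) (m : 'X_{1..2}) :
  p \is d.-homog ->
  p@_m = if (mdeg m == d) then form_coef d p (m 1) else 0.
Proof.
move=> hp; case: eqP => [<-|/eqP dm]; last first.
  exact: (dhomog_nemf_coeff hp).
by rewrite /form_coef multinom2_deg.
Qed.

Lemma dhomog2_eval (R : comNzRingType) d (p : {mpoly R[2]}) (v : 'I_2 -> R) :
  p \is d.-homog -> p.@[v] = form_eval d (form_coef d p) (v 0) (v 1).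
Proof.
move=> hp; pose mon k : 'X_{1..2} := [multinom [tuple (d - k)%N; k]].
have mdegm k : (k <= d)%N -> mdeg (mon k) = d.
  by move=> kd; rewrite mdeg2 !multinomE !(tnth_nth 0%N) /= subnK.
have E : p = \sum_(k < d.+1) form_coef d p k *: 'X_[mon k].
  apply/mpolyP => m; rewrite (dhomog2_coef _ hp) raddf_sum /=.
  case: eqP => [dm|/eqP dm]; last first.
    rewrite big1 // => k _; rewrite mcoeffZ mcoeffX.
    case: eqP => [km|_]; last by rewrite mulr0.
    by rewrite -km mdegm ?eqxx // -ltnS in dm.
  have lt1 : (m 1%R < d.+1)%N by rewrite ltnS -dm mdeg2 leq_addl.
  rewrite (bigD1 (Ordinal lt1)) //= mcoeffZ mcoeffX.
  have -> : mon (m 1) = m by rewrite /mon -dm multinom2_deg.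
  rewrite eqxx mulr1 big1 ?addr0 // => k nk; rewrite mcoeffZ mcoeffX.
  case: eqP => [km|_]; last by rewrite mulr0.
  by case/eqP: nk; apply: val_inj; rewrite /= -km multinomE (tnth_nth 0%N).
rewrite {1}E raddf_sum /form_eval; apply: eq_bigr => k _ /=.
rewrite mevalZ mevalX !big_ord_recl big_ord0 mulr1.
rewrite !multinomE !(tnth_nth 0%N) /=.
by congr (_ * (_ * v _ ^+ _)); apply: val_inj.
Qed.

(** * The factorization of the resultant *)

Lemma bracket_map (R S : comNzRingType) (phi : {rmorphism R -> S})
    (x y z w : 'rV[R]_4) :
  bracket (map_mx phi x) (map_mx phi y) (map_mx phi z) (map_mx phi w) =
  phi (bracket x y z w).
Proof. by rewrite !bracketE /= !mxE !(rmorphD, rmorphN, rmorphM). Qed.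

Lemma map_toep_up (R S : comNzRingType) (phi : {rmorphism R -> S}) d p :
  map_mx phi (toep_up d p) = toep_up d (phi \o p).
Proof. by apply/matrixP => i j; rewrite !mxE rmorphMn. Qed.

Lemma map_toep_low (R S : comNzRingType) (phi : {rmorphism R -> S}) d p :
  map_mx phi (toep_low d p) = toep_low d (phi \o p).
Proof. by apply/matrixP => i j; rewrite !mxE rmorphMn. Qed.

Lemma map_bezout_mx (R S : comNzRingType) (phi : {rmorphism R -> S}) d a w :
  map_mx phi (bezout_mx d a w) =
  bezout_mx d (fun i => phi \o a i) (fun i k => phi (w i k)).
Proof.
rewrite /bezout_mx raddf_sum; apply: eq_bigr => i _ /=.
rewrite raddf_sum; apply: eq_bigr => k _ /=.
by rewrite map_mxZ map_mxM map_toep_up map_toep_low.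
Qed.

(** Dual Pluecker coordinates of the line through x and y. *)
Definition line_coord (R : comNzRingType) (x y : 'rV[R]_4) (i k : 'I_4) : R :=
  bracket x y (delta_mx 0 i) (delta_mx 0 k).

(** The factorization at the level of coefficients. The minors of two planes
    through a line are the coordinates of that line up to a common factor, and
    the Pluecker relation identifies this factor as a bracket. *)
Lemma det_sylv_planes (R : comNzRingType) d a (x g p q : 'rV[R]_4) :
  \det (sylv d (comb (cross x g p) a) (comb (cross x g q) a)) =
  \det (bezout_mx d a (line_coord x g)) * bracket x g p q ^+ d.
Proof.
rewrite det_sylv_comb mulrC -det_bezout_mxZ; congr (\det _).
by apply: eq_bezout_mx => i k; rewrite !mxE bracket_plucker.
Qed.

Lemma bracket_eq0 (K : fieldType) (x a b c : 'rV[K]_4) :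
  noncollinear a b c -> (bracket x a b c == 0) = (x <= span3 a b c)%MS.
Proof.
rewrite /noncollinear => fr.
have E : \matrix_(i < 4) nth 0 [:: x; a; b; c] i
    = col_mx x (span3 a b c) :> 'M_(1 + 3, 4).
  apply/matrixP => i j; rewrite mxE; case: (split_ordP i) => k ->.
    by rewrite col_mxEu ord1.
  by rewrite col_mxEd mxE.
rewrite /bracket -[_ == 0]negbK -unitfE -unitmxE -row_free_unit /row_free.
have -> : \rank (\matrix_(i < 4) nth 0 [:: x; a; b; c] i)
    = \rank (x + span3 a b c)%MS.
  by rewrite [in LHS]E addsmxE.
have [le1 le2] := mxrank_leqif_sup (addsmxSr x (span3 a b c)).
rewrite addsmx_sub submx_refl andbT in le2; rewrite -le2.
move: fr le1 (rank_leq_col (x + span3 a b c)%MS); rewrite /row_free => /eqP ->.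
by case: (\rank _) => [|[|[|[|[|n]]]]].
Qed.

Lemma dhomog_prod1 (R : comNzRingType) n d (F : 'I_d -> {mpoly R[n]}) :
  (forall i, F i \is 1.-homog) -> \prod_i F i \is d.-homog.
Proof.
elim: d F => [|d IH] F hF; first by rewrite big_ord0 dhomog1.
by rewrite big_ord_recl; apply: (@dhomogM _ _ _ 1 _ d); rewrite ?IH.
Qed.

Lemma dhomog_det (R : comNzRingType) n d (M : 'M[{mpoly R[n]}]_d) :
  (forall i j, M i j \is 1.-homog) -> \det M \is d.-homog.
Proof.
move=> hM; apply: rpred_sum => s _; rewrite mulr_sign.
by case: ifP => _; rewrite ?rpredN dhomog_prod1.
Qed.

Section SymbolicPoint.
Variable K : fieldType.

Definition sym_pt : 'rV[{mpoly K[4]}]_4 := \row_j 'X_j.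

Definition cst_pt (v : 'rV[K]_4) : 'rV[{mpoly K[4]}]_4 :=
  map_mx (@mpolyC 4 K) v.

Lemma cst_pt_delta i : cst_pt (delta_mx 0 i) = delta_mx 0 i.
Proof. exact: map_delta_mx. Qed.

Lemma meval_cst_pt (x : 'rV[K]_4) v : map_mx (meval (x 0)) (cst_pt v) = v.
Proof. by apply/rowP => i; rewrite !mxE mevalC. Qed.

Lemma meval_sym_pt (x : 'rV[K]_4) : map_mx (meval (x 0)) sym_pt = x.
Proof. by apply/rowP => i; rewrite !mxE mevalXU. Qed.

Lemma meval_bracket_sym (x : 'rV[K]_4) a b c :
  (bracket sym_pt (cst_pt a) (cst_pt b) (cst_pt c)).@[x 0] = bracket x a b c.
Proof. by rewrite -bracket_map meval_sym_pt !meval_cst_pt. Qed.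

Lemma dhomog_bracket_sym a b c :
  bracket sym_pt (cst_pt a) (cst_pt b) (cst_pt c) \is 1.-homog.
Proof.
rewrite bracket_swap03 rpredN bracket_dot rpred_sum // => i _.
rewrite -cst_pt_delta bracket_map mulrC mul_mpolyC rpredZ // mxE.
by rewrite dhomogX /= mdeg1.
Qed.

Lemma dhomog_bezout_mx d (a : 'I_4 -> nat -> K) w (i j : 'I_d) :
  (forall l k, w l k \is 1.-homog) ->
  bezout_mx d (fun i => @mpolyC 4 K \o a i) w i j \is 1.-homog.
Proof.
move=> hw; rewrite /bezout_mx summxE rpred_sum // => l _.
rewrite summxE rpred_sum // => k _.
by rewrite -map_toep_up -map_toep_low -map_mxM !mxE mulrC mul_mpolyC rpredZ.
Qed.

Lemma plane_formE (G P : 'rV[K]_4) :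
  plane_form G P = \sum_i 'X_i * (cross sym_pt (cst_pt G) (cst_pt P) 0 i)%:MP.
Proof.
pose C := map_mx (@mpolyC 4 {mpoly K[4]}).
have -> : plane_form G P =
    bracket (C _ _ sym_pt) (C _ _ (cst_pt G)) (C _ _ (cst_pt P)) (\row_j 'X_j).
  congr (\det _); apply/matrixP => i j; rewrite [LHS]mxE [RHS]mxE.
  by case: i => -[|[|[|[|//]]]] i /=; rewrite !mxE.
rewrite bracket_dot; apply: eq_bigr => i _; rewrite !mxE.
by rewrite -(map_delta_mx (@mpolyC 4 {mpoly K[4]})) bracket_map.
Qed.

Definition param_coef (f : 4.-tuple {mpoly K[2]}) (i : 'I_4) : nat -> K :=
  form_coef (param_deg f) (tnth f i).

Lemma form_coef_plane (f : 4.-tuple {mpoly K[2]}) (G P : 'rV[K]_4) k :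
  form_coef (param_deg f) (plane_form_on_curve f G P) k =
  comb (cross sym_pt (cst_pt G) (cst_pt P))
    (fun i => @mpolyC 4 K \o param_coef f i) k.
Proof.
rewrite /form_coef /plane_form_on_curve plane_formE.
rewrite (raddf_sum (comp_mpoly _)) raddf_sum /=; apply: eq_bigr => i _.
rewrite rmorphM /= comp_mpolyC comp_mpolyXU mulrC mcoeffCM.
by rewrite (nth_map i) ?size_tuple // nth_ord_enum mcoeff_map_mpoly.
Qed.

(** The equation of the cone with apex G over the curve: the cofactor of the
    plane through G, P0, P1 in the resultant. Independence from P0 and P1 is
    built into the formula, and used below to move these points. *)
Definition cone (f : 4.-tuple {mpoly K[2]}) (G : 'rV[K]_4) : {mpoly K[4]} :=
  \det (bezout_mx (param_deg f) (fun i => @mpolyC 4 K \o param_coef f i)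
          (line_coord sym_pt (cst_pt G))).

Lemma curve_resultantE f (G P0 P1 : 'rV[K]_4) :
  curve_resultant f G P0 P1 =
  cone f G * bracket sym_pt (cst_pt G) (cst_pt P0) (cst_pt P1) ^+ param_deg f.
Proof.
rewrite -det_sylv_planes /curve_resultant /form_resultant form_Sylvester_mxE.
congr (\det _); apply/matrixP => i j.
congr ((block_mx _ _ _ _ : 'M_(_, _)) i j);
  by apply/matrixP => ? ?; rewrite !mxE form_coef_plane.
Qed.

Lemma meval_cone f (G x : 'rV[K]_4) :
  (cone f G).@[x 0] =
  \det (bezout_mx (param_deg f) (param_coef f) (line_coord x G)).
Proof.
rewrite /cone -det_map_mx map_bezout_mx; congr (\det _).
rewrite /bezout_mx; apply: eq_bigr => i _; apply: eq_bigr => k _.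
rewrite /line_coord -(cst_pt_delta i) -(cst_pt_delta k) /= meval_bracket_sym.
congr (_ *: (_ *m _));
  by apply/matrixP => ? ?; rewrite !mxE /= mevalC.
Qed.

Lemma dhomog_cone f (G : 'rV[K]_4) : cone f G \is (param_deg f).-homog.
Proof.
apply: dhomog_det => i j; apply: dhomog_bezout_mx => l k.
by rewrite /line_coord -!cst_pt_delta dhomog_bracket_sym.
Qed.

(** * The cone contains the curve *)

Lemma dot_param_eval f (l : 'rV[K]_4) (t : 'rV[K]_2) : curve_param f ->
  dot l (param_eval f t) =
  form_eval (param_deg f) (comb l (param_coef f)) (t 0 0) (t 0 1).
Proof.
case=> hom _ _; rewrite /dot /form_eval /comb.
under [RHS]eq_bigr do rewrite mulr_suml.
rewrite exchange_big; apply: eq_bigr => i _ /=.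
rewrite mxE (dhomog2_eval _ (hom i)) mulr_sumr; apply: eq_bigr => k _.
by rewrite mulrA.
Qed.

(** If some coordinate [y G e_i e_k] is nonzero, the planes through y, G, e_i
    and through y, G, e_k cut the curve in a common point, so their resultant
    vanishes, while the bracket dividing it does not. Otherwise the matrix
    defining the cone is zero at y. *)
Lemma cone_on_curve f (G x : 'rV[K]_4) : curve_param f -> on_curve f x ->
  (cone f G).@[x 0] = 0.
Proof.
move=> hf [t [c [tn0 cn0 ->]]]; rewrite meval_cone; set y := _ *: _.
have [_ _ d0] := hf.
have [/existsP[i /existsP[k nik]]|none] :=
  boolP [exists i, exists k, line_coord y G i k != 0].
  have := det_sylv_planes (param_deg f) (param_coef f) y G
    (delta_mx 0 i) (delta_mx 0 k).
  have root0 p : form_eval (param_deg f)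
      (comb (cross y G p) (param_coef f)) (t 0 0) (t 0 1) = 0.
    rewrite -dot_param_eval //; apply: (mulfI cn0).
    rewrite mulr0 -(bracket_alt03 y G p) [RHS]bracket_dot mulr_sumr.
    by apply: eq_bigr => l _; rewrite !mxE; ring.
  rewrite (det_sylv_root d0 (s := t 0 0) (t := t 0 1)) ?root0 //; last first.
    apply: contraNT tn0; rewrite negb_or !negbK => /andP[/eqP t0 /eqP t1].
    apply/eqP/rowP => l; rewrite mxE; case: l => -[|[|//]] l.
      by rewrite -[RHS]t0; congr (t _ _); apply: val_inj.
    by rewrite -[RHS]t1; congr (t _ _); apply: val_inj.
  by move/esym/eqP; rewrite mulf_eq0 expf_eq0 (negPf nik) andbF orbF => /eqP.
(* Written 0 * 0, the zero tensor is a tensor scaled by 0. *)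
have w0 i k : line_coord y G i k = 0 * 0.
  by move/existsPn/(_ i)/existsPn/(_ k): none; rewrite negbK mulr0 => /eqP.
rewrite (eq_bezout_mx _ _ w0) (det_bezout_mxZ _ _ 0 (fun _ _ => 0)).
by rewrite expr0n -[_ == _]negbK -lt0n d0 mul0r.
Qed.

End SymbolicPoint.

(** * The cone is a proper surface *)

(** At the intersection point xi of l, m and a plane y off G, the line through
    xi and G is the intersection of l and m, so its coordinates are the minors
    of (l, m) up to the factor - y(G); hence the value of the cone at xi is a
    nonzero multiple of the resultant of l(f) and m(f). *)
Lemma cone_neq0_planes (K : fieldType) (f : 4.-tuple {mpoly K[2]})
    (G l m : 'rV[K]_4) :
  G != 0 -> dot l G = 0 -> dot m G = 0 ->
  \det (sylv (param_deg f)
          (comb l (param_coef f)) (comb m (param_coef f))) != 0 ->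
  cone f G != 0.
Proof.
move=> /rV0Pn[a Ga] lG mG nz.
pose y : 'rV[K]_4 := delta_mx 0 a; pose xi := cross l m y.
suff: (cone f G).@[xi 0] != 0 by apply: contraNneq => ->; rewrite meval0.
have yG : dot y G = G 0 a.
  by rewrite -dot_delta /dot; apply: eq_bigr => i _; rewrite mulrC.
have E i k : line_coord xi G i k = - G 0 a * (l 0 i * m 0 k - l 0 k * m 0 i).
  by rewrite /line_coord bracket_cross // !dot_delta yG.
rewrite meval_cone (eq_bezout_mx _ _ E) det_bezout_mxZ -det_sylv_comb.
by rewrite mulf_neq0 // expf_neq0 // oppr_eq0.
Qed.

(** When the coordinate of index a of G is nonzero, these forms, for varying k,
    span the linear forms vanishing at G. *)
Definition vanishing_form (R : comNzRingType) (G : 'rV[R]_4) (a k : 'I_4) :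
    'rV[R]_4 :=
  G 0 a *: delta_mx 0 k - G 0 k *: delta_mx 0 a.

Lemma dot_vanishing_form (R : comNzRingType) (G x : 'rV[R]_4) a k :
  dot (vanishing_form G a k) x = G 0 a * x 0 k - G 0 k * x 0 a.
Proof.
rewrite -[x 0 k]dot_delta -[x 0 a]dot_delta /dot !mulr_sumr -sumrB.
by apply: eq_bigr => i _; rewrite !mxE; ring.
Qed.

(** A common zero of all the forms vanishing at G is proportional to G. *)
Lemma vanishing_form_on_curve (K : fieldType) (f : 4.-tuple {mpoly K[2]})
    (G : 'rV[K]_4) a (t : 'rV[K]_2) :
  curve_param f -> ~ on_curve f G -> G 0 a != 0 -> t != 0 ->
  exists k, dot (vanishing_form G a k) (param_eval f t) != 0.
Proof.
move=> [_ nz _] hG Ga tn0; set x := param_eval f t.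
apply/existsP; apply: contra_notT hG => /existsPn none.
have E k : G 0 a * x 0 k = G 0 k * x 0 a.
  by have := none k; rewrite negbK dot_vanishing_form subr_eq0 => /eqP.
have xa : x 0 a != 0.
  apply: contraNneq (nz t tn0) => xa0; apply/eqP/rowP => k; rewrite [RHS]mxE.
  by apply: (mulfI Ga); rewrite E xa0 !mulr0.
exists t, (G 0 a / x 0 a); split; rewrite ?mulf_neq0 ?invr_neq0 //.
apply/rowP => k; rewrite [RHS]mxE -/x; apply: (mulIf xa).
by rewrite -E mulrAC divfK.
Qed.

(** The first plane l through G is chosen to miss the point of the curve at the
    parameter (0 : 1). It then meets the curve in finitely many points
    f(1 : r). The second plane m is taken in the one-parameter family
    sum_k s^k v_k, where the v_k span the planes through G: for each r, only
    finitely many s give a plane through f(1 : r), so some s avoids them all. *)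
Lemma cone_neq0 (K : closedFieldType) (f : 4.-tuple {mpoly K[2]})
    (G : 'rV[K]_4) :
  curve_param f -> ~ on_curve f G -> G != 0 -> cone f G != 0.
Proof.
move=> hf hG Gn0; have [a Ga] := rV0Pn _ Gn0.
pose d := param_deg f.
pose pol (l : 'rV[K]_4) := \poly_(i < d.+1) comb l (param_coef f) i.
pose pt (s t : K) : 'rV[K]_2 := \row_j (if j == 0 then s else t).
have evE l s t :
    dot l (param_eval f (pt s t)) = form_eval d (comb l (param_coef f)) s t.
  by rewrite dot_param_eval // !mxE.
have pol_eval l r : (pol l).[r] = dot l (param_eval f (pt 1 r)).
  rewrite evE horner_poly; apply: eq_bigr => i _.
  by rewrite expr1n mul1r.
have pt1_neq0 r : pt 1 r != 0.
  by apply/eqP => /rowP/(_ 0)/eqP; rewrite !mxE oner_eq0.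
have ptinf_neq0 : pt 0 1 != 0.
  by apply/eqP => /rowP/(_ 1)/eqP; rewrite !mxE oner_eq0.
have [k0 hk0] := vanishing_form_on_curve hf hG Ga ptinf_neq0.
set l := vanishing_form G a k0 in hk0.
have ld : comb l (param_coef f) d != 0.
  move: hk0; rewrite evE /form_eval big_ord_recr big1 => [|i _].
    by rewrite /= add0r subnn expr0 mul1r expr1n mulr1.
  by rewrite expr0n subn_eq0 leqNgt /= ltn_ord mul0r mulr0.
have [rs prs] := closed_field_poly_normal (pol l).
(* q r, evaluated at s, is the value at f(1 : r) of the plane of parameter s. *)
pose q r := \sum_(k < 4)
  (dot (vanishing_form G a k) (param_eval f (pt 1 r)))%:P * 'X^k.
have qn0 r : q r != 0.
  have [k hk] := vanishing_form_on_curve hf hG Ga (pt1_neq0 r).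
  apply: contraNneq hk => /(congr1 (coefp k)) /=.
  rewrite coef0 coef_sum (bigD1 k) //= coefCM coefXn eqxx mulr1.
  rewrite big1 ?addr0 => [->//|j jk].
  by rewrite coefCM coefXn eq_sym (inj_eq val_inj) (negPf jk) mulr0.
have : \prod_(r <- rs) q r != 0.
  by rewrite prodf_seq_neq0; apply/allP => r _; rewrite qn0.
case/closed_nonrootP => s; rewrite rootE horner_prod prodf_seq_neq0 => /allP sP.
pose m : 'rV[K]_4 := \sum_(k < 4) s ^+ k *: vanishing_form G a k.
have mE x : dot m x = \sum_(k < 4) dot (vanishing_form G a k) x * s ^+ k.
  rewrite /dot; under [RHS]eq_bigr do rewrite mulr_suml.
  rewrite exchange_big; apply: eq_bigr => i _ /=; rewrite summxE mulr_suml.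
  by apply: eq_bigr => k _; rewrite [in LHS]mxE; ring.
have vanG k : dot (vanishing_form G a k) G = 0.
  by rewrite dot_vanishing_form mulrC subrr.
apply: (cone_neq0_planes (l := l) (m := m)) => //.
- exact: vanG.
- by rewrite mE big1 // => k _; rewrite vanG mul0r.
apply: det_sylv_neq0 => //.
apply: Pdiv.ClosedField.root_coprimep => r root_r.
have rrs : r \in rs.
  move: root_r; rewrite -/(pol l) prs rootZ ?root_prod_XsubC //.
  apply: contraNneq ld => /eqP; rewrite lead_coef_eq0 => /eqP pl0.
  have := coef_poly d.+1 (comb l (param_coef f)) d.
  by rewrite ltnSn -/(pol l) pl0 coef0 => <-.
have := sP r rrs; rewrite /= -/(pol m) pol_eval mE /q horner_sum.
congr (_ != 0); apply: eq_bigr => k _.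
by rewrite hornerM hornerC hornerXn.
Qed.

Lemma noncollinear_neq0 (K : fieldType) (a b c : 'rV[K]_4) :
  noncollinear a b c -> a != 0.
Proof.
move=> fr; apply/eqP => a0.
have : (delta_mx 0 0 : 'rV[K]_3) *m span3 a b c == 0.
  by rewrite -rowE; apply/eqP/rowP => j; rewrite !mxE a0 mxE.
rewrite mulmx_free_eq0 // => /eqP/matrixP/(_ 0 0)/eqP.
by rewrite !mxE oner_eq0.
Qed.

Theorem lemma5 (K : closedFieldType) (f : 4.-tuple {mpoly K[2]})
    (G P0 P1 : 'rV[K]_4)
    (hf : curve_param f)
    (hG : ~ on_curve f G)
    (hGP : noncollinear G P0 P1) :
  exists S E : {mpoly K[4]},
    [/\ S != 0,
        S \is (param_deg f).-homog,
        forall x : 'rV[K]_4, on_curve f x -> S.@[x 0] = 0,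
        defines_plane E G P0 P1
      & curve_resultant f G P0 P1 = S * E ^+ param_deg f].
Proof.
exists (cone f G), (bracket (sym_pt K) (cst_pt G) (cst_pt P0) (cst_pt P1)).
split.
- exact/cone_neq0/(noncollinear_neq0 hGP).
- exact: dhomog_cone.
- by move=> x; apply: cone_on_curve.
- split; first exact: dhomog_bracket_sym.
  by move=> x; rewrite meval_bracket_sym bracket_eq0.
- exact: curve_resultantE.
Qed.
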